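(* The only admissible $2$-partitions of the Coxeter graphs $E_6$, $E_7$, $E_8$ are the bipartite ones and the following $2$-partition of $E_6$: $\{\alpha,\beta\}$ where $\alpha$ is the set of the three vertices of degree $1$ (leaves) of the graph $E_6$ and $\beta$ is the set of the three other vertices. That is, for $\Gamma$ of type $E_6$, $E_7$ or $E_8$, a $2$-partition of the vertex set is admissible if and only if it is the bipartite partition of $\Gamma$, or $\Gamma=E_6$ and it is the partition {leaves, non-leaves}.
   Context: A Coxeter matrix over a set $I$ is a family $\Gamma=(m_{i,j})_{i,j\in I}$ with $m_{i,j}=m_{j,i}\in\mathbb N_{\geq 1}\cup\{\infty\}$ and $m_{i,j}=1\iff i=j$; its Coxeter graph has vertex set $I$, an edge $\{i,j\}$ when $m_{i,j}\ge3$, labelled by $m_{i,j}$ when $m_{i,j}\geq 4$. $E_6,E_7,E_8$ are the usual irreducible spherical (finite type) Coxeter graphs. $W=W_\Gamma$ is the associated Coxeter group with generators $s_i$ ($i\in I$) and $\ell$ is word length on $W$. For $J\subseteq I$ with $W_J=\langle s_j\mid j\in J\rangle$ finite ($J$ spherical), $r_J$ denotes the unique element of maximal length of $W_J$. A $2$-partition is a partition $\{\alpha,\beta\}$ of $I$ into exactly two (non-empty) parts. It is admissible if $\alpha,\beta$ are spherical and, with $\tilde W=\langle r_\alpha,r_\beta\rangle\subseteq W$, for every $w\in\tilde W$ and every $\gamma\in\{\alpha,\beta\}$, either $\ell(ws_i)=\ell(w)+1$ for all $i\in\gamma$, or $\ell(ws_i)=\ell(w)-1$ for all $i\in\gamma$.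 The bipartite partition of $\Gamma$ (whose graph is a tree) is the unique $2$-partition of $I$ such that no edge joins two vertices of the same part. *)

(* Defs.v *)
From HB Require Import structures.
From mathcomp Require Import all_boot.
From mathcomp Require Import boolp classical_sets cardinality.
Set Implicit Arguments.
Unset Strict Implicit.
Unset Printing Implicit Defensive.
Local Open Scope quotient_scope.
Local Open Scope group_scope.

(* Labels are in option nat; None stands for infinity. *)
Record coxeter_matrix (I : eqType) := CoxeterMatrix {
  cox_entry :> I -> I -> option nat;
  cox_sym : forall i j, cox_entry i j = cox_entry j i;
  cox_neq0 : forall i j, cox_entry i j != Some 0%N;
  cox_eq1 : forall i j, (cox_entry i j == Some 1%N) = (i == j)
}.

Definition cox_isomorphic (I J : eqType)
    (M : coxeter_matrix I) (N : coxeter_matrix J) : Prop :=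
  exists2 f : I -> J, bijective f & forall i j, N (f i) (f j) = M i j.

Definition cox_edge (I : eqType) (M : coxeter_matrix I) : rel I :=
  fun i j => if M i j is Some m then (3 <= m)%N else true.

Definition cox_degree (I : finType) (M : coxeter_matrix I) (i : I) : nat :=
  #|[set j | cox_edge M i j]|.

Definition cox_leaves (I : finType) (M : coxeter_matrix I) : {set I} :=
  [set i | cox_degree M i == 1%N].

Section CoxeterGroup.
Variables (I : choiceType) (M : coxeter_matrix I).

(* The congruence on the free monoid of words generated by (s_i s_j)^m = 1
   for m = M i j finite.  The case i = j gives s_i^2 = 1, so the quotient
   monoid is the group with the same presentation. *)
Inductive cox_equiv : seq I -> seq I -> Prop :=
| CoxRel i j m u v : M i j = Some m ->
    cox_equiv (u ++ flatten (nseq m [:: i; j]) ++ v) (u ++ v)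
| CoxRefl u : cox_equiv u u
| CoxSym u v : cox_equiv u v -> cox_equiv v u
| CoxTrans v u w : cox_equiv u v -> cox_equiv v w -> cox_equiv u w.

Definition cox_equivb (u v : seq I) : bool := `[< cox_equiv u v >].

Lemma cox_equivb_refl : reflexive cox_equivb.
Proof. by move=> u; apply/asboolP/CoxRefl. Qed.

Lemma cox_equivb_sym : symmetric cox_equivb.
Proof. by move=> u v; apply/asboolP/asboolP => /CoxSym. Qed.

Lemma cox_equivb_trans : transitive cox_equivb.
Proof.
by move=> v u w /asboolP uv /asboolP vw; apply/asboolP/(CoxTrans uv vw).
Qed.

Canonical cox_equivb_rel :=
  EquivRel cox_equivb cox_equivb_refl cox_equivb_sym cox_equivb_trans.

Definition coxeter_group : Type := {eq_quot cox_equivb_rel}.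
HB.instance Definition _ := EqQuotient.on coxeter_group.
HB.instance Definition _ := Choice.on coxeter_group.

Definition cox_word (v : seq I) : coxeter_group := \pi_coxeter_group v.

Lemma cox_wordP u v : reflect (cox_equiv u v) (cox_word u == cox_word v).
Proof. by rewrite eqmodE; apply: asboolP. Qed.

Lemma cox_word_surj (x : coxeter_group) : exists v, x = cox_word v.
Proof. by elim/quotW: x => v; exists v. Qed.

Lemma cox_equiv_ctx a b u v : cox_equiv u v -> cox_equiv (a ++ u ++ b) (a ++ v ++ b).
Proof.
elim=> {u v} [i j m u v e|u|u v _|v u w _ + _]; last exact: CoxTrans.
- have := CoxRel (a ++ u) (v ++ b) e; by rewrite -!catA.
- exact: CoxRefl.
- exact: CoxSym.
Qed.

Lemma cox_equiv_cat u u' v v' :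
  cox_equiv u u' -> cox_equiv v v' -> cox_equiv (u ++ v) (u' ++ v').
Proof.
move=> uu' vv'; apply: (@CoxTrans (u' ++ v)).
  exact: (cox_equiv_ctx [::] v uu').
by have := cox_equiv_ctx u' [::] vv'; rewrite !cats0.
Qed.

Lemma cox_equiv_rev u v : cox_equiv u v -> cox_equiv (rev u) (rev v).
Proof.
elim=> {u v} [i j m u v e|u|u v _|v u w _ + _].
- rewrite !rev_cat -catA.
  have -> : rev (flatten (nseq m [:: i; j])) = flatten (nseq m [:: j; i]).
    by rewrite rev_flatten map_nseq rev_nseq.
  by apply: CoxRel; rewrite cox_sym.
- exact: CoxRefl.
- exact: CoxSym.
- exact: CoxTrans.
Qed.

Lemma cox_equiv_revK u : cox_equiv (rev u ++ u) [::].
Proof.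
elim: u => [|i u IH]; first exact: CoxRefl.
rewrite rev_cons cat_rcons; apply: CoxTrans IH.
have /eqP e : M i i == Some 1%N by rewrite cox_eq1.
exact: (CoxRel (rev u) u e).
Qed.

Definition cox_one : coxeter_group := cox_word [::].
Definition cox_inv (x : coxeter_group) : coxeter_group := cox_word (rev (repr x)).
Definition cox_mul (x y : coxeter_group) : coxeter_group :=
  cox_word (repr x ++ repr y).

Lemma cox_repr v : cox_equiv (repr (cox_word v)) v.
Proof. by apply/cox_wordP; rewrite /cox_word reprK. Qed.

Lemma cox_mulE u v : cox_mul (cox_word u) (cox_word v) = cox_word (u ++ v).
Proof. by apply/eqP/cox_wordP/cox_equiv_cat; apply: cox_repr. Qed.

Lemma cox_invE u : cox_inv (cox_word u) = cox_word (rev u).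
Proof. by apply/eqP/cox_wordP/cox_equiv_rev/cox_repr. Qed.

Lemma cox_mulA : associative cox_mul.
Proof.
move=> x y z; have [u ->] := cox_word_surj x; have [v ->] := cox_word_surj y.
by have [w ->] := cox_word_surj z; rewrite !cox_mulE catA.
Qed.

Lemma cox_mul1g : left_id cox_one cox_mul.
Proof. by move=> x; have [u ->] := cox_word_surj x; rewrite cox_mulE. Qed.

Lemma cox_mulg1 : right_id cox_one cox_mul.
Proof. by move=> x; have [u ->] := cox_word_surj x; rewrite cox_mulE cats0. Qed.

Lemma cox_mulVg : left_inverse cox_one cox_inv cox_mul.
Proof.
move=> x; have [u ->] := cox_word_surj x; rewrite cox_invE cox_mulE.
exact/eqP/cox_wordP/cox_equiv_revK.
Qed.

Lemma cox_mulgV : right_inverse cox_one cox_inv cox_mul.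
Proof.
move=> x; have [u ->] := cox_word_surj x; rewrite cox_invE cox_mulE.
by apply/eqP/cox_wordP; have := cox_equiv_revK (rev u); rewrite revK.
Qed.

HB.instance Definition _ := isGroup.Build coxeter_group
  cox_mulA cox_mul1g cox_mulg1 cox_mulVg cox_mulgV.

Definition cox_gen (i : I) : coxeter_group := cox_word [:: i].

Lemma cox_wordE v : cox_word v = \prod_(i <- v) cox_gen i.
Proof.
elim: v => [|i v IH]; first by rewrite big_nil.
by rewrite big_cons -IH; symmetry; apply: cox_mulE.
Qed.

Definition has_word_of_size (w : coxeter_group) (n : nat) : bool :=
  `[< exists2 v : seq I, size v = n & w = \prod_(i <- v) cox_gen i >].

Lemma has_word_ex w : exists n, has_word_of_size w n.
Proof.
have [v ->] := cox_word_surj w; exists (size v).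
by apply/asboolP; exists v => //; apply: cox_wordE.
Qed.

Definition cox_length (w : coxeter_group) : nat := ex_minn (has_word_ex w).

End CoxeterGroup.

Definition is_subgroup (G : groupType) (H : set G) : Prop :=
  [/\ H 1, (forall x y, H x -> H y -> H (x * y)) & (forall x, H x -> H x^-1)].

Definition generated_subgroup (G : groupType) (A : set G) : set G :=
  smallest (@is_subgroup G) A.

Section Admissible.
Variables (I : finType) (M : coxeter_matrix I).
Implicit Types (J : {set I}) (P : {set {set I}}).

Definition parabolic J : set (coxeter_group M) :=
  generated_subgroup (cox_gen M @` [set` J])%classic.

Definition spherical J : Prop := finite_set (parabolic J).

Definition is_longest J (r : coxeter_group M) : Prop :=
  parabolic J r /\
  forall w, parabolic J w -> w <> r -> (cox_length w < cox_length r)%N.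

(* Meaningful only for J spherical; 1 is a default value. *)
Definition longest J : coxeter_group M := xget 1 [set r | is_longest J r]%classic.

Definition two_partition P : Prop :=
  finset.partition P [set: I] /\ #|P| = 2%N.

Definition admissible P : Prop :=
  [/\ two_partition P,
      forall J, J \in P -> spherical J
    & forall w : coxeter_group M,
        generated_subgroup (longest @` [set` P])%classic w ->
        forall J, J \in P ->
          (forall i, i \in J ->
             cox_length (w * cox_gen M i) = (cox_length w).+1)
          \/ (forall i, i \in J ->
             cox_length w = (cox_length (w * cox_gen M i)).+1)].

Definition bipartite_partition P : Prop :=
  two_partition P /\
  forall J, J \in P -> forall i j, i \in J -> j \in J -> ~~ cox_edge M i j.

End Admissible.

(* For n in {6, 7, 8}: the path 0 - 2 - 3 - ... - (n-1), with the vertex 1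
   attached to 3 (Bourbaki's labels shifted by one). *)
Definition E_arrow (i j : nat) : bool :=
  [|| (i == 0) && (j == 2), (i == 1) && (j == 3)
    | (2 <= i)%N && (j == i.+1)]%N.

Definition E_entry (n : nat) (i j : 'I_n) : option nat :=
  if i == j then Some 1%N
  else if E_arrow i j || E_arrow j i then Some 3%N else Some 2%N.

Lemma E_entry_sym n (i j : 'I_n) : E_entry i j = E_entry j i.
Proof. by rewrite /E_entry eq_sym orbC. Qed.

Lemma E_entry_neq0 n (i j : 'I_n) : E_entry i j != Some 0%N.
Proof. by rewrite /E_entry; case: ifP => // _; case: ifP. Qed.

Lemma E_entry_eq1 n (i j : 'I_n) : (E_entry i j == Some 1%N) = (i == j).
Proof. by rewrite /E_entry; case: ifP => // _; case: ifP. Qed.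

Definition E_matrix (n : nat) : coxeter_matrix 'I_n :=
  CoxeterMatrix (@E_entry_sym n) (@E_entry_neq0 n) (@E_entry_eq1 n).

(* Main.v *)
Require Import Defs.
From mathcomp Require Import all_boot order ssralg ssrnum ssrint ring zify.
From mathcomp Require Import boolp classical_sets cardinality.

(** The geometric representation of a simply laced Coxeter group W on the root
    lattice decides right ascents: l(w s_i) = l(w) + 1 exactly when the
    coordinates of the root w alpha_i are nonnegative.  Hence w in W_J is the
    longest element of W_J once it sends every alpha_j (j in J) to a negative
    root, and an element acting trivially on the simple roots is 1.  The group
    generated by the involutions r_alpha and r_beta consists of their alternating
    products, so admissibility of a 2-partition amounts to a sign condition on
    the roots w alpha_i for w in one period of alternating products, which is
    evaluated for each of the 2-partitions of E_6, E_7 and E_8. *)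

Set Implicit Arguments.
Unset Strict Implicit.
Unset Printing Implicit Defensive.
Import Order.TTheory GRing.Theory Num.Theory.

(** Since the generators are involutions, the inverse of a product of generators is the reversed
    product. Hence the subgroup consists of such products, and right multiplication by one generator
    suffices for induction. *)
Lemma generated_subgroup_ind (G : groupType) (A : set G) (Q : G -> Prop) :
  (forall a, A a -> (a * a = 1)%g) -> Q 1%g ->
  (forall w a, Q w -> A a -> Q (w * a)%g) ->
  forall w, generated_subgroup A w -> Q w.
Proof.
move=> AA Q1 QM w genw.
pose H w := exists2 s : seq G, (w = \prod_(a <- s) a)%g & forall a, a \in s -> A a.
have [s -> As] : H w.
  apply: (genw H); split=> [|a Aa]; last first.
    by exists [:: a]; [rewrite big_seq1 | move=> b; rewrite inE => /eqP->].
  split=> [|_ _ [s -> As] [t -> At]|_ [s -> As]].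
  - by exists [::]; rewrite ?big_nil.
  - exists (s ++ t); first by rewrite big_cat.
    by move=> a; rewrite mem_cat => /orP[/As|/At].
  - exists (rev s); last by move=> a; rewrite mem_rev => /As.
    elim: s As => [|a s IHs] As; first by rewrite !big_nil invg1.
    rewrite big_cons rev_cons -cats1 big_cat big_seq1 invgM IHs; last first.
      by move=> b bs; apply: As; rewrite inE bs orbT.
    congr (_ * _)%g; apply: (mulgI a).
    by rewrite mulgV AA //; apply: As; rewrite mem_head.
elim/last_ind: s As => [|s a IHs] As; first by rewrite big_nil.
rewrite -cats1 big_cat big_seq1; apply: QM.
  by apply: IHs => b bs; apply: As; rewrite mem_rcons inE bs orbT.
by apply: As; rewrite mem_rcons mem_head.
Qed.

(** * Word length in a Coxeter group and the relations of rank two *)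

Section Length.
Variables (I : finType) (M : coxeter_matrix I).
Implicit Types (i j : I) (u v : seq I) (w : coxeter_group M).
Local Notation s := (cox_gen M).
Local Notation len := (@cox_length _ M).

Lemma cox_word_cat u v : (cox_word M (u ++ v) = cox_word M u * cox_word M v)%g.
Proof. by symmetry; apply: cox_mulE. Qed.

Lemma cox_word_rcons u i : (cox_word M (rcons u i) = cox_word M u * s i)%g.
Proof. by rewrite -cats1 cox_word_cat. Qed.

Lemma cox_gen_sq i : (s i * s i = 1)%g.
Proof.
rewrite -cox_word_cat /=; apply/eqP/cox_wordP.
have /eqP e : M i i == Some 1 by rewrite cox_eq1.
exact: (CoxRel [::] [::] e).
Qed.

Lemma mulg_genK w i : (w * s i * s i = w)%g.
Proof. by rewrite -mulgA cox_gen_sq mulg1. Qed.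

Lemma cox_length_word u : len (cox_word M u) <= size u.
Proof.
rewrite /cox_length; case: ex_minnP => n _; apply.
by apply/asboolP; exists u => //; apply: cox_wordE.
Qed.

Lemma cox_reduced w : exists2 u : seq I, size u = len w & w = cox_word M u.
Proof.
rewrite /cox_length; case: ex_minnP => n /asboolP[u su wu] _.
by exists u => //; rewrite cox_wordE.
Qed.

Lemma cox_length_eq0 w : len w = 0 -> w = 1%g.
Proof. by have [u <- ->] := cox_reduced w; move/size0nil ->. Qed.

Lemma cox_length1 : len 1%g = 0.
Proof. by have := cox_length_word [::]; rewrite leqn0 => /eqP. Qed.

(** Each relator [(s_i s_j)^m] has even length, so the parity of words survives in the group; this
    later excludes [len (w * s i) = len w]. *)
Lemma cox_equiv_odd u v : cox_equiv M u v -> odd (size u) = odd (size v).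
Proof.
elim=> {u v} [i j m u v _|u|u v _ ->|u v w _ -> _ ->] //.
by rewrite !size_cat !oddD size_flatten /shape map_nseq sumn_nseq oddM.
Qed.

Lemma cox_length_odd u : odd (len (cox_word M u)) = odd (size u).
Proof.
have [v <- /eqP/cox_wordP uv] := cox_reduced (cox_word M u).
by rewrite (cox_equiv_odd uv).
Qed.

Lemma cox_length_mulgen_le w i : len (w * s i)%g <= (len w).+1.
Proof.
have [u <- ->] := cox_reduced w.
by rewrite -cox_word_rcons (leq_trans (cox_length_word _)) // size_rcons.
Qed.

Lemma cox_length_mulgen w i :
  len (w * s i)%g = (len w).+1 \/ len w = (len (w * s i)%g).+1.
Proof.
have := cox_length_mulgen_le w i.
have := cox_length_mulgen_le (w * s i)%g i; rewrite mulg_genK.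
have : odd (len (w * s i)%g) = ~~ odd (len w).
  have [u ->] := cox_word_surj w.
  by rewrite -cox_word_rcons !cox_length_odd size_rcons.
by lia.
Qed.

(** The last letter of a reduced word is a descent. *)
Lemma cox_length_descent w :
  0 < len w -> exists i, len w = (len (w * s i)%g).+1.
Proof.
have [u] := cox_reduced w; case/lastP: u => [<- //|u i].
rewrite size_rcons cox_word_rcons => su wE _; exists i.
have wi : (w * s i = cox_word M u)%g by rewrite wE mulg_genK.
have := cox_length_mulgen_le (w * s i)%g i; have := cox_length_word u.
by rewrite mulg_genK wi; lia.
Qed.

Lemma cox_gen_comm i j : M i j = Some 2 -> (s i * s j = s j * s i)%g.
Proof.
move=> Mij; have /eqP := introT (cox_wordP _ _ _) (CoxRel [::] [::] Mij).
rewrite /= (cox_word_cat [:: i; j] [:: i; j]) !(cox_word_cat [:: i] [:: j]) => e.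
apply: (mulgI (s i * s j)%g); rewrite [LHS]e.
by rewrite mulgA mulg_genK cox_gen_sq.
Qed.

Lemma cox_gen_braid i j :
  M i j = Some 3 -> (s i * s j * s i = s j * s i * s j)%g.
Proof.
move=> Mij; have /eqP := introT (cox_wordP _ _ _) (CoxRel [::] [::] Mij).
rewrite /= (cox_word_cat [:: i; j] [:: i; j; i; j]).
rewrite (cox_word_cat [:: i; j] [:: i; j]) !(cox_word_cat [:: i] [:: j]) => e.
apply: (mulIg (s j * s i * s j)%g); transitivity (1%g : coxeter_group M).
  by move: e; rewrite !mulgA.
by rewrite !mulgA !mulg_genK cox_gen_sq.
Qed.

End Length.

(** * The geometric representation and the signs of roots *)

Definition simply_laced (I : eqType) (M : coxeter_matrix I) : Prop :=
  forall i j, i != j -> M i j = Some 2 \/ M i j = Some 3.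

Section Representation.
Local Open Scope ring_scope.
Variables (I : finType) (M : coxeter_matrix I).
Hypothesis slM : simply_laced M.
Implicit Types (i j k : I) (u : seq I) (w : coxeter_group M) (v : I -> int).
Local Notation s := (cox_gen M).
Local Notation len := (@cox_length _ M).

(* The pairing of [v] with the coroot of [i]. *)
Definition pairing i v : int := 2 * v i - \sum_(j | cox_edge M i j) v j.
Definition alpha i : I -> int := fun k => (k == i)%:R.
Definition reflection i v : I -> int := fun k => v k - pairing i v * alpha i k.
Definition act u v : I -> int := foldr reflection v u.

Lemma cox_edgeii i : cox_edge M i i = false.
Proof.
by rewrite /cox_edge; have /eqP -> : M i i == Some 1%N by rewrite cox_eq1.
Qed.

Lemma cox_edge_sym i j : cox_edge M i j = cox_edge M j i.
Proof. by rewrite /cox_edge cox_sym. Qed.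

Lemma pairing_alpha i j :
  pairing i (alpha j) = if i == j then 2 else - (cox_edge M i j)%:R.
Proof.
rewrite /pairing /alpha; have -> : \sum_(k | cox_edge M i k) (k == j)%:R
    = (cox_edge M i j)%:R :> int.
  have [ij|nij] := boolP (cox_edge M i j).
    rewrite (bigD1 j) //= eqxx big1 ?addr0 // => k /andP[_ /negbTE->] //.
  rewrite big1 // => k ik; case: eqP => // kj.
  by rewrite -kj ik in nij.
by case: eqP => [->|_]; rewrite ?cox_edgeii ?mulr1 ?subr0 // mulr0 sub0r.
Qed.

Lemma reflectionE i v k : reflection i v k = v k - pairing i v * alpha i k.
Proof. by []. Qed.

Lemma pairing_reflection i j v : pairing i (reflection j v)
  = pairing i v - pairing j v * pairing i (alpha j).
Proof.
rewrite {1 2 4}/pairing /reflection sumrB -mulr_sumr; ring.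
Qed.

Lemma reflectionK i : involutive (reflection i).
Proof.
move=> v; apply/funext => k.
by rewrite !reflectionE pairing_reflection pairing_alpha eqxx; ring.
Qed.

Lemma reflection_comm i j v : i != j -> M i j = Some 2%N ->
  reflection i (reflection j v) = reflection j (reflection i v).
Proof.
move=> ij Mij; apply/funext => k.
have e0 : cox_edge M i j = false by rewrite /cox_edge Mij.
have aij : pairing i (alpha j) = 0 by rewrite pairing_alpha (negbTE ij) e0.
have aji : pairing j (alpha i) = 0.
  by rewrite pairing_alpha eq_sym (negbTE ij) cox_edge_sym e0.
by rewrite !reflectionE !pairing_reflection aij aji; ring.
Qed.

Lemma reflection_braid i j v : i != j -> M i j = Some 3%N ->
  reflection i (reflection j (reflection i v))
  = reflection j (reflection i (reflection j v)).
Proof.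
move=> ij Mij; apply/funext => k.
have e1 : cox_edge M i j = true by rewrite /cox_edge Mij.
have aij : pairing i (alpha j) = -1 by rewrite pairing_alpha (negbTE ij) e1.
have aji : pairing j (alpha i) = -1.
  by rewrite pairing_alpha eq_sym (negbTE ij) cox_edge_sym e1.
have aii l : pairing l (alpha l) = 2 by rewrite pairing_alpha eqxx.
by rewrite !reflectionE !pairing_reflection aij aji !aii; ring.
Qed.

Lemma act_cat u u' v : act (u ++ u') v = act u (act u' v).
Proof. exact: foldr_cat. Qed.

(** Makes the action well defined on the group. In simply laced type only relators with [m] equal to
    1, 2 or 3 occur, and they act trivially because the reflections are involutions that commute or
    braid. *)
Lemma act_cox_equiv u u' v : cox_equiv M u u' -> act u v = act u' v.
Proof.
move=> e; elim: e v => {u u'} [i j m u u' Mij|u|u u' _ IH|u u' u'' _ IH1 _ IH2] v //.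
- rewrite !act_cat; congr act; set v' := act u' v; have [ij|ij] := eqVneq i j.
    have m1 : m = 1%N.
      by have := cox_eq1 M i j; rewrite Mij ij eqxx => /eqP[->].
    by rewrite m1 ij /act /= reflectionK.
  have [Mij2|Mij3] := slM ij; move: Mij; rewrite ?Mij2 ?Mij3 => -[<-] /=.
    by rewrite (reflection_comm v' ij Mij2) !reflectionK.
  by rewrite (reflection_braid _ ij Mij3) !reflectionK.
- by rewrite IH1.
Qed.

Definition rep w v : I -> int := act (repr w) v.

Lemma rep_word u v : rep (cox_word M u) v = act u v.
Proof. by apply: act_cox_equiv; apply: cox_repr. Qed.

Lemma rep1 v : rep 1%g v = v.
Proof. exact: (rep_word [::]). Qed.

Lemma repM w w' v : rep (w * w')%g v = rep w (rep w' v).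
Proof.
have [u ->] := cox_word_surj w; have [u' ->] := cox_word_surj w'.
by rewrite -cox_word_cat !rep_word act_cat.
Qed.

Lemma rep_gen i v : rep (s i) v = reflection i v.
Proof. exact: (rep_word [:: i]). Qed.

Lemma act_sum (J : finType) u (c : J -> int) (F : J -> I -> int) k :
  act u (fun l => \sum_j c j * F j l) k = \sum_j c j * act u (F j) k.
Proof.
elim: u k => //= i u IHu k.
have -> : act u (fun l => \sum_j c j * F j l)
    = (fun l => \sum_j c j * act u (F j) l) by apply/funext.
rewrite /reflection /pairing exchange_big /= mulr_sumr -sumrB mulr_suml -sumrB.
apply: eq_bigr => j _; rewrite -mulr_sumr; ring.
Qed.

Lemma rep_expand w v k : rep w v k = \sum_i v i * rep w (alpha i) k.
Proof.
rewrite /rep -act_sum; congr (act _ _ k); apply/funext => l.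
rewrite (bigD1 l) //= /alpha eqxx big1 ?addr0 ?mulr1 // => i il.
by rewrite eq_sym (negbTE il) mulr0.
Qed.

Lemma rep_lin w a v v' :
  rep w (fun k => a * v k + v' k) = fun k => a * rep w v k + rep w v' k.
Proof.
apply/funext => k; rewrite 3!(rep_expand w) mulr_sumr -big_split /=.
by apply: eq_bigr => i _; ring.
Qed.

Definition root w i := rep w (alpha i).

Lemma root1 i : root 1%g i = alpha i.
Proof. exact: rep1. Qed.

(** Update rule for right multiplication: only the roots at [i] and at its neighbours change. The
    tables below implement it. *)
Lemma root_mulgen w i j : root (w * s i)%g j
  = fun k => - pairing i (alpha j) * root w i k + root w j k.
Proof.
rewrite /root repM rep_gen -rep_lin; congr rep.
by apply/funext => k; rewrite /reflection; ring.
Qed.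

Lemma root_mulgen_same w i : root (w * s i)%g i = fun k => - root w i k.
Proof.
by rewrite root_mulgen pairing_alpha eqxx; apply/funext => k; ring.
Qed.

Definition nonneg v := [forall k, 0 <= v k].

Lemma nonnegP v : reflect (forall k, 0 <= v k) (nonneg v).
Proof. exact: forallP. Qed.

(* Induction on [len w], peeling off from [w] the letters [i] and [j] of the rank
   two parabolic subgroup generated by [i] and a descent [j] of [w]. *)
Lemma root_nonneg w i : (len w < len (w * s i)%g)%N -> nonneg (root w i).
Proof.
have [n] := ubnP (len w); elim: n => // n IHn in w i *; rewrite ltnS => wn wi.
have [w0|] := posnP (len w).
  by apply/nonnegP => k; rewrite (cox_length_eq0 w0) root1 ler0n.
move/cox_length_descent => [j wj].
have ij : i != j by apply: contraPneq wi => ->; rewrite wj; lia.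
set w' := (w * s j)%g in wj.
have ww' : w = (w' * s j)%g by rewrite mulg_genK.
clearbody w'.
have lt_w'j : (len w' < len (w' * s j)%g)%N by rewrite -ww' wj.
have w'j := IHn _ _ (leq_trans (eq_leq (esym wj)) wn) lt_w'j.
have pij : pairing j (alpha i) = - (cox_edge M i j)%:R.
  by rewrite pairing_alpha eq_sym (negbTE ij) cox_edge_sym.
(* If [i] is an ascent of [w'], then [root w i] is a nonnegative combination of [root w' i] and
   [root w' j]. *)
have [w'i|w'i] := cox_length_mulgen w' i.
  have {}w'i : nonneg (root w' i) by apply: IHn; lia.
  rewrite ww' root_mulgen pij; apply/nonnegP => k; rewrite opprK.
  by rewrite addr_ge0 // ?mulr_ge0 ?ler0n //; apply/nonnegP: k.
have [Mij|Mij] := slM ij.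
  (* Commuting case: [w * s i = w' * s i * s j] has length at most [len w'], against the ascent
     [wi]. *)
  exfalso; move: wi; rewrite {2}ww' -mulgA -(cox_gen_comm Mij) mulgA.
  by rewrite ltnNge wj w'i (leq_trans (cox_length_mulgen_le _ _)).
(* Braid case: [w = x * s i * s j], and [s i * s j] sends [alpha i] to [alpha j], so
   [root w i = root x j]. Here [j] is an ascent of [x], as otherwise [w * s i = x * s j * s i * s j]
   would be shorter than [w]. *)
set x := (w' * s i)%g in w'i.
have w'x : w' = (x * s i)%g by rewrite mulg_genK.
clearbody x.
have wix : (w * s i = x * s j * s i * s j)%g.
  by rewrite ww' w'x -!mulgA [(s i * _)%g]mulgA (cox_gen_braid Mij) !mulgA.
have xj : (len x < len (x * s j)%g)%N.
  have [->//|xj] := cox_length_mulgen x j.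
  move: wi; rewrite wix wj w'i xj ltnNge (leq_trans (cox_length_mulgen_le _ _)) //.
  by rewrite ltnS (leq_trans (cox_length_mulgen_le _ _)).
have -> : root w i = root x j.
  have eij : cox_edge M i j by rewrite /cox_edge Mij.
  have {}pij : pairing j (alpha i) = -1 by rewrite pij eij.
  have pji : pairing i (alpha j) = -1 by rewrite pairing_alpha (negbTE ij) eij.
  rewrite ww' root_mulgen w'x root_mulgen_same root_mulgen pij pji.
  by apply/funext => k; ring.
by apply: IHn => //; lia.
Qed.

Lemma root_nonpos w i :
  (len (w * s i)%g < len w)%N -> nonneg (fun k => - root w i k).
Proof.
move=> wi; rewrite -root_mulgen_same; apply: root_nonneg.
by rewrite mulg_genK.
Qed.

(** Applying [w^-1] to a zero root would give [alpha i = 0]. *)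
Lemma root_neq0 w i : ~ (forall k, root w i k = 0).
Proof.
move=> w0; have := rep_expand w^-1%g (root w i) i.
rewrite /root -repM mulVg rep1 /alpha eqxx big1 // => j _.
by rewrite [rep _ _ _]w0 mul0r.
Qed.

Lemma root_sign w i : nonneg (root w i) -> nonneg (fun k => - root w i k) -> False.
Proof.
move=> /nonnegP w_ge0 /nonnegP w_le0; apply: (@root_neq0 w i) => k.
by apply/eqP; rewrite eq_le w_ge0 -oppr_ge0 w_le0.
Qed.

(** A root is nonzero, hence cannot have both signs; the two one-sided sign results thus become an
    equivalence. *)
Lemma nonneg_rootE w i : nonneg (root w i) = (len (w * s i)%g == (len w).+1).
Proof.
have [wi|wi] := cox_length_mulgen w i.
  by rewrite wi eqxx; apply: root_nonneg; rewrite wi.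
have -> : (len (w * s i)%g == (len w).+1) = false by lia.
by apply/negP => /root_sign; apply; apply: root_nonpos; lia.
Qed.

Lemma Nnonneg_rootE w i : ~~ nonneg (root w i) = (len w == (len (w * s i)%g).+1).
Proof. by rewrite nonneg_rootE; have := cox_length_mulgen w i; lia. Qed.

Lemma Nnonneg_root w i : ~~ nonneg (root w i) -> nonneg (fun k => - root w i k).
Proof. by rewrite Nnonneg_rootE => /eqP wi; apply: root_nonpos; rewrite wi. Qed.

Lemma all_nonneg_root1 w : (forall i, nonneg (root w i)) -> w = 1%g.
Proof.
move=> w_ge0; apply/cox_length_eq0; have [//|] := posnP (len w).
move=> /cox_length_descent [i wi]; have := w_ge0 i; rewrite nonneg_rootE; lia.
Qed.

(** Simple roots are nonnegative, so such a [w] has no descent. Relations in the group can thus be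
    verified on integer coordinates. *)
Lemma rep_faithful w : (forall i, root w i = alpha i) -> w = 1%g.
Proof.
move=> w1; apply: all_nonneg_root1 => i; rewrite w1.
by apply/nonnegP => k; rewrite ler0n.
Qed.

End Representation.

(** * Longest elements of parabolic subgroups, recognised by their descents *)

Section Longest.
Variables (I : finType) (M : coxeter_matrix I).
Hypothesis slM : simply_laced M.
Implicit Types (i j k : I) (u : seq I) (w x r : coxeter_group M) (J : {set I}).
Local Notation s := (cox_gen M).
Local Notation len := (@cox_length _ M).

Definition ascent w i : bool := nonneg (root w i).

Lemma parabolic1 J : parabolic J (1%g : coxeter_group M).
Proof. by move=> H [[]]. Qed.

Lemma parabolicM J w x : parabolic J w -> parabolic J x -> parabolic J (w * x)%g.
Proof.
by move=> Jw Jx H HJ; case: (HJ) => -[_ HM _] _; apply: HM; [apply: Jw|apply: Jx].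
Qed.

Lemma parabolicV J w : parabolic J w -> parabolic J w^-1%g.
Proof. by move=> Jw H HJ; case: (HJ) => -[_ _ HV] _; apply: HV; apply: Jw. Qed.

Lemma parabolic_gen J i : i \in J -> parabolic J (s i).
Proof. by move=> iJ H [_ HJ]; apply: HJ; exists i. Qed.

Lemma parabolic_word J u : all (mem J) u -> parabolic J (cox_word M u).
Proof.
elim/last_ind: u => [_|u i IHu]; first exact: parabolic1.
rewrite all_rcons cox_word_rcons => /andP[iJ /IHu Ju].
by apply: parabolicM Ju _; apply: parabolic_gen.
Qed.

(** A reflection alters only its own coordinate, and here its index lies in [J]. *)
Lemma rep_parabolic J w v k : parabolic J w -> k \notin J -> rep w v k = v k.
Proof.
move=> Jw kJ; elim/generated_subgroup_ind: Jw v => [_ [i _ <-]| |] {w}.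
- exact: cox_gen_sq.
- by move=> v; rewrite rep1.
- move=> w _ IHw [i /= iJ <-] v; rewrite repM // IHw rep_gen // /reflection /alpha.
  by case: eqP kJ => [->|_ _]; rewrite ?iJ // mulr0 subr0.
Qed.

(** For [i] outside [J] the coordinate [i] of [root w i] keeps the value 1, so this root cannot be
    negative; the descent that [w] must have therefore lies in [J]. *)
Lemma parabolic_descent J w :
  parabolic J w -> w <> 1%g -> exists2 i, i \in J & ~~ ascent w i.
Proof.
move=> Jw w1; have [i wi] : exists i, ~~ ascent w i.
  apply: contrapT => /forallNP w_ge0; apply: w1; apply: all_nonneg_root1 => // i.
  by apply/negbNE/negP/w_ge0.
exists i => //; apply: contraT => iJ; move/(Nnonneg_root slM)/nonnegP: wi => /(_ i).
by rewrite /root (rep_parabolic _ Jw iJ) /alpha eqxx.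
Qed.

(** Expand [v] on the simple roots of [J], each of which [w] makes nonpositive. *)
Lemma rep_nonpos J w v :
  (forall j, j \in J -> ~~ ascent w j) ->
  nonneg v -> (forall k, k \notin J -> v k = 0%R) ->
  nonneg (fun k => - rep w v k)%R.
Proof.
move=> wJ /nonnegP v_ge0 vJ; apply/nonnegP => k.
rewrite rep_expand // -sumrN sumr_ge0 // => i _; rewrite -mulrN.
have [/wJ/(Nnonneg_root slM)/nonnegP wi|/vJ->] := boolP (i \in J);
  last by rewrite mul0r.
exact: mulr_ge0 (v_ge0 i) (wi k).
Qed.

(** Induction on [len x]. For a descent [i] of [x] in [J], the root of [x * s i] at [i] is
    nonnegative with support in [J], so [r] makes it nonpositive: restoring the letter [i] to
    [x * s i] shortens the product with [r] by one. *)
Lemma length_longestM J r x : (forall j, j \in J -> ~~ ascent r j) ->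
  parabolic J x -> len (r * x)%g + len x = len r.
Proof.
move=> rJ; have [n] := ubnP (len x); elim: n => // n IHn in x *.
rewrite ltnS => xn Jx.
have [->|/eqP x1] := eqVneq x 1%g; first by rewrite mulg1 cox_length1 addn0.
have [i iJ xi] := parabolic_descent Jx x1.
have /eqP xiE : len x == (len (x * s i)%g).+1 by rewrite -Nnonneg_rootE.
have Jxi : parabolic J (x * s i)%g by apply: parabolicM => //; apply: parabolic_gen.
have xin : len (x * s i)%g < n by rewrite -xiE.
suff rE : len (r * (x * s i))%g = (len (r * x)%g).+1.
  by rewrite -(IHn _ xin Jxi) rE xiE addSnnS.
have -> : (r * x = r * (x * s i) * s i)%g by rewrite mulgA mulg_genK.
apply/eqP; rewrite -Nnonneg_rootE //; apply/negP => /(root_sign slM); apply.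
rewrite /root repM //; apply: rep_nonpos rJ _ _.
  by apply: root_nonneg => //; rewrite mulg_genK; lia.
move=> k kJ; rewrite (rep_parabolic _ Jxi kJ) /alpha.
by case: eqP kJ => // ->; rewrite iJ.
Qed.

(** The length formula at [x = r^-1 * w] shows that [len w] falls short of [len r] by [len x], which
    is positive unless [w = r]. *)
Lemma is_longest_descent J r : parabolic J r ->
  (forall j, j \in J -> ~~ ascent r j) -> is_longest J r.
Proof.
move=> Jr rJ; split=> // w Jw wr.
have Jx : parabolic J (r^-1 * w)%g by apply: parabolicM => //; apply: parabolicV.
have := length_longestM rJ Jx; rewrite mulVKg => <-.
rewrite -[X in (X < _)%N]addn0 ltn_add2l lt0n; apply/eqP => /cox_length_eq0 x1.
by apply: wr; rewrite -(mulVKg r w) x1 mulg1.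
Qed.

(** Strict maximality makes the longest element unique, so [xget] returns [r] and not by default. *)
Lemma longestE J r : parabolic J r ->
  (forall j, j \in J -> ~~ ascent r j) -> longest M J = r.
Proof.
move=> Jr rJ; have [_ r_max] := is_longest_descent Jr rJ.
apply: xget_unique; first exact: is_longest_descent.
move=> r' [Jr' r'_max]; apply: contrapT => /nesym r'r.
by have := r_max _ Jr' (nesym r'r); have := r'_max _ Jr r'r; lia.
Qed.

(** The length formula at [x = r] leaves [len (r * r) = 0]. *)
Lemma longest_sq J r : parabolic J r ->
  (forall j, j \in J -> ~~ ascent r j) -> (r * r = 1)%g.
Proof.
by move=> Jr rJ; apply: cox_length_eq0; have := length_longestM rJ Jr; lia.
Qed.

(** By the length formula, [len r] bounds all lengths in the parabolic subgroup, which is thus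
    covered by finitely many words. *)
Lemma spherical_descent J r : (forall j, j \in J -> ~~ ascent r j) -> spherical M J.
Proof.
move=> rJ.
have fin : finite_set
    [set cox_word M (u : seq I) | u in [set: (len r).-bseq I]]%classic.
  by apply: finite_image; apply: finite_finset.
apply: sub_finite_set fin => x Jx.
have [u ux ->] := cox_reduced x; have := length_longestM rJ Jx.
rewrite -ux => ur; have szu : size u <= len r by lia.
by exists (Bseq szu).
Qed.

Definition uniform w J : bool :=
  [forall (i | i \in J), ascent w i] || [forall (i | i \in J), ~~ ascent w i].

Lemma uniformP w J : reflect
  ((forall i, i \in J -> len (w * s i)%g = (len w).+1)
   \/ (forall i, i \in J -> len w = (len (w * s i)%g).+1)) (uniform w J).
Proof.
apply: (iffP orP) => -[] wJ; [left|right|left|right].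
- by move=> i iJ; apply/eqP; rewrite -nonneg_rootE //; apply: (forall_inP wJ).
- by move=> i iJ; apply/eqP; rewrite -Nnonneg_rootE //; apply: (forall_inP wJ).
- by apply/forall_inP => i /wJ /eqP; rewrite -nonneg_rootE.
- by apply/forall_inP => i /wJ /eqP; rewrite -Nnonneg_rootE.
Qed.

End Longest.

(** * Alternating products of two involutions *)

Section Alternating.
Variables (G : groupType) (a b : G).

Fixpoint alternating (k : nat) : G :=
  if k is k'.+1 then (alternating k' * (if odd k' then b else a))%g else 1%g.

Lemma alternating_generated (A : set G) k :
  A a -> A b -> generated_subgroup A (alternating k).
Proof.
move=> Aa Ab H [[H1 HM _] AH]; elim: k => //= k IHk.
by apply: HM => //; case: ifP => _; apply: AH.
Qed.

(* With period [n.*2] the products starting with [a] also cover those starting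
   with [b], since [b] itself is the product of the first [n.*2.-1] factors. *)
Lemma generated_alternating (A : set G) n w :
  (forall x, A x -> x = a \/ x = b) -> (a * a = 1)%g -> (b * b = 1)%g ->
  0 < n -> alternating n.*2 = 1%g ->
  generated_subgroup A w -> exists2 k, k < n.*2 & w = alternating k.
Proof.
move=> Aab aa bb n0 per; elim/generated_subgroup_ind => {w} [x /Aab[]->//| |].
  by exists 0; rewrite ?double_gt0.
(* A factor equal to the last one cancels; the other one prolongs the product, and length [n.*2]
   wraps around to 0. *)
move=> _ x [k kn ->] /Aab[]->; have [k_odd|k_even] := boolP (odd k).
- case: k kn k_odd => //= k kn /negbTE k_even; exists k; first exact: ltnW.
  by rewrite k_even -mulgA aa mulg1.
- exists k.+1; last by rewrite /= (negbTE k_even).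
  rewrite ltn_neqAle kn andbT; apply: contra k_even => /eqP/(congr1 odd).
  by rewrite /= odd_double => /negbFE.
- have kE : alternating k.+1 = (alternating k * b)%g by rewrite /= k_odd.
  have [kn'|] := ltnP k.+1 n.*2; first by exists k.+1.
  move=> nk; exists 0; rewrite ?double_gt0 // -kE.
  by have -> : k.+1 = n.*2 by apply/eqP; rewrite eqn_leq kn.
- case: k kn k_even => [_ _|k kn]; last first.
    rewrite /= negbK => k_odd; exists k; first exact: ltnW.
    by rewrite k_odd -mulgA bb mulg1.
  case: n n0 per => // n _; rewrite doubleS /= odd_double => per.
  exists n.*2.+1 => //; apply: (mulIg b).
  by rewrite mul1g bb -[LHS]per /= odd_double.
Qed.

End Alternating.

(** * Admissibility of a set and its complement, tested on alternating products *)

Section AdmissibleCriterion.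
Variables (I : finType) (M : coxeter_matrix I).
Hypothesis slM : simply_laced M.
Variables (J : {set I}) (r r' : coxeter_group M).
Hypotheses (Jr : parabolic J r) (rJ : forall j, j \in J -> ~~ ascent r j).
Hypotheses (Jr' : parabolic (~: J) r')
  (rJ' : forall j, j \in ~: J -> ~~ ascent r' j).
Hypothesis PJ : two_partition [set J; ~: J].

Definition uniform_pair (w : coxeter_group M) : bool :=
  uniform w J && uniform w (~: J).

(** Alternating products lie in the group generated by the two longest elements, so one that is not
    uniform refutes admissibility. *)
Lemma admissible_uniform : admissible M [set J; ~: J] ->
  forall k, uniform_pair (alternating r r' k).
Proof.
move=> [_ _ adm] k.
have {}adm K : K \in [set J; ~: J] -> uniform (alternating r r' k) K.
  move=> PK; apply/uniformP => //; apply: adm PK.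
  apply: alternating_generated.
    by exists J; [rewrite /= !inE eqxx | apply: longestE].
  by exists (~: J); [rewrite /= !inE eqxx orbT | apply: longestE].
by rewrite /uniform_pair !adm // !inE eqxx ?orbT.
Qed.

(** Sphericity comes from [r] and [r']; the products within one period exhaust the generated group,
    so finitely many tests suffice. *)
Lemma uniform_admissible n : 0 < n -> alternating r r' n.*2 = 1%g ->
  (forall k, k < n.*2 -> uniform_pair (alternating r r' k)) ->
  admissible M [set J; ~: J].
Proof.
move=> n0 per unif; split=> // [K|w gen_w K PK].
  rewrite !inE => /orP[]/eqP->; first exact: spherical_descent rJ.
  exact: spherical_descent rJ'.
apply/uniformP => //.
have [k kn ->] : exists2 k, k < n.*2 & w = alternating r r' k.
  apply: generated_alternating gen_w => // [_ [L + <-]||].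
  - by rewrite /= !inE => /orP[]/eqP->; [left|right]; apply: longestE.
  - exact: longest_sq rJ.
  - exact: longest_sq rJ'.
have /andP[] := unif k kn.
by move: PK; rewrite !inE => /orP[]/eqP->.
Qed.

End AdmissibleCriterion.

(** * Computable encodings of subsets, partitions and group elements *)

Fixpoint all_bitseq (n : nat) (p : pred bitseq) : bool :=
  if n is n'.+1 then
    all_bitseq n' (fun m => p (true :: m)) && all_bitseq n' (fun m => p (false :: m))
  else p [::].

Lemma all_bitseqP n p m : all_bitseq n p -> size m = n -> p m.
Proof.
move=> + mn; rewrite -{n}mn; elim: m p => //= b m IHm p /andP[pt pf].
by case: b; [apply: (IHm (p \o cons true))|apply: (IHm (p \o cons false))].
Qed.

Definition E_adj (i j : nat) : bool := E_arrow i j || E_arrow j i.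

Lemma E_adjii i : E_adj i i = false.
Proof. by rewrite /E_adj /E_arrow; lia. Qed.

Definition bits (n : nat) (m : bitseq) : seq nat :=
  [seq i <- iota 0 n | nth false m i].

Lemma mem_bits n m k : (k \in bits n m) = nth false m k && (k < n).
Proof. by rewrite mem_filter mem_iota. Qed.

Lemma nth_negb n m k :
  size m = n -> k < n -> nth false (map negb m) k = ~~ nth false m k.
Proof. by move=> <- km; rewrite (nth_map false). Qed.

Definition proper_coloring (n : nat) (m : bitseq) : bool :=
  all (fun i => all (fun j => E_adj i j ==> (nth false m i != nth false m j))
                 (iota 0 n)) (iota 0 n).

Definition leaf_bits (n : nat) (m : bitseq) : bool :=
  all (fun i => nth false m i == (count (E_adj i) (iota 0 n) == 1)) (iota 0 n).

Lemma all_iotaP n (p : pred nat) :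
  reflect (forall k, k < n -> p k) (all p (iota 0 n)).
Proof.
by apply: (iffP allP) => np k kn; apply: np; rewrite mem_iota in kn *.
Qed.

(* An element [w] of the Coxeter group of type E_n is represented by the table
   whose row [k] lists the coordinates of the root [w alpha_k]. *)
Definition table := seq (seq int).

Definition entry (g : table) (k l : nat) : int := nth 0%R (nth [::] g k) l.

Section Tables.
Variable n : nat.

Definition table1 : table := mkseq (fun k => mkseq (fun l => (k == l)%:R%R) n) n.

(** Row form of [root_mulgen]: the old row [i] changes sign and is added to the rows of the
    neighbours of [i], whose pairing with it is -1. *)
Definition table_mulgen (g : table) (i : nat) : table :=
  mkseq (fun k =>
    if k == i then mkseq (fun l => - entry g i l)%R n
    else if E_adj i k then mkseq (fun l => entry g i l + entry g k l)%R n
    else nth [::] g k) n.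

Definition table_mul (g : table) (u : seq nat) : table := foldl table_mulgen g u.

Definition table_ascent (g : table) (i : nat) : bool :=
  all (fun l => 0 <= entry g i l)%R (iota 0 n).

Definition table_uniform (g : table) (J : seq nat) : bool :=
  all (table_ascent g) J || all (fun i => ~~ table_ascent g i) J.

(** Greedy search along ascents in [J]. The output is only a candidate, certified afterwards by
    [is_longest_word]. *)
Fixpoint longest_word (fuel : nat) (J : seq nat) (g : table) : seq nat :=
  if fuel is f.+1 then
    if [seq i <- J | table_ascent g i] is i :: _ then
      i :: longest_word f J (table_mulgen g i)
    else [::]
  else [::].

Definition is_longest_word (J u : seq nat) : bool :=
  all (mem J) u && all (fun i => ~~ table_ascent (table_mul table1 u) i) J.

Fixpoint table_alternating (u v : seq nat) (k : nat) : table :=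
  if k is k'.+1 then table_mul (table_alternating u v k') (if odd k' then v else u)
  else table1.

(** The running table costs one multiplication per step, and exchanging [u] and [v] alternates the
    factors. Unlike [&&], the [if] stops at the first failure even under eager evaluation. *)
Fixpoint all_alternating (p : pred table) (g : table) (u v : seq nat) (k : nat) :
    bool :=
  if k is k'.+1 then
    if p g then all_alternating p (table_mul g u) v u k' else false
  else true.

Lemma all_alternatingE p u v k :
  all_alternating p table1 u v k = all (p \o table_alternating u v) (iota 0 k).
Proof.
(* Generalised to a start at index [j], whose parity decides which word comes next. *)
suff H j : all_alternating p (table_alternating u v j) (if odd j then v else u)
    (if odd j then u else v) k = all (p \o table_alternating u v) (iota j k).
  exact: (H 0).
elim: k j => //= k IHk j; have := IHk j.+1; rewrite /= !if_neg => ->.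
by case: (p _).
Qed.

(* A longest element of a proper parabolic subgroup has length at most 63 (for E_7
   in E_8), whence the fuel 64.  [2 h] is a common period of the alternating
   products of the admissible partitions; for the others, one of the first ten
   products is not uniform. *)
Definition check_bits (h : nat) (m : bitseq) : bool :=
  let J := bits n m in let K := bits n (map negb m) in
  if nilp J || nilp K then true else
  let u := longest_word 64 J table1 in
  let v := longest_word 64 K table1 in
  let unif := all_alternating
    (fun g => table_uniform g J && table_uniform g K) table1 u v in
  [&& is_longest_word J u, is_longest_word K v &
    if proper_coloring n m || (n == 6) && (leaf_bits n m || leaf_bits n (map negb m))
    then (table_alternating u v h.*2 == table1) && unif h.*2
    else ~~ unif 10].

End Tables.

(* The bipartite partition gives a product [r_alpha r_beta] of order the Coxeter
   number 12, 18 or 30, the other one of E_6 a product of order 8, whence 24. *)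
Lemma check_E6 : all_bitseq 6 (check_bits 6 24). Proof. by vm_compute. Qed.
Lemma check_E7 : all_bitseq 7 (check_bits 7 18). Proof. by vm_compute. Qed.
Lemma check_E8 : all_bitseq 8 (check_bits 8 30). Proof. by vm_compute. Qed.

(** * From tables to a Coxeter group with numbered vertices *)

Section TypeE.
Variables (I : finType) (M : coxeter_matrix I) (n : nat) (x : nat -> I).
Hypothesis xM : forall i j, i < n -> j < n -> M (x i) (x j) =
  if i == j then Some 1 else if E_adj i j then Some 3 else Some 2.
Hypothesis x_surj : forall y, exists2 k, k < n & y = x k.
Implicit Types (g : table) (w : coxeter_group M) (m : bitseq) (u v : seq nat).

(** The label 1 occurs exactly on the diagonal, so the labels alone force the numbering to be
    injective below [n]. *)
Lemma x_eq i j : i < n -> j < n -> (x i == x j) = (i == j).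
Proof.
move=> ltin ltjn; rewrite -(cox_eq1 M) xM //.
by case: (i == j) => //; case: ifP.
Qed.

Lemma x_edge i j : i < n -> j < n -> cox_edge M (x i) (x j) = E_adj i j.
Proof.
move=> ltin ltjn; rewrite /cox_edge xM //.
by case: eqP => [->|_]; [rewrite E_adjii|case: ifP].
Qed.

Lemma simply_laced_x : simply_laced M.
Proof.
move=> y z; have [i ltin ->] := x_surj y; have [j ltjn ->] := x_surj z.
by rewrite x_eq // xM // => /negbTE->; case: ifP; [right|left].
Qed.
Let slM := simply_laced_x.

Definition tabulates g w : Prop :=
  forall k l, k < n -> l < n -> entry g k l = root w (x k) (x l).

Lemma tabulates1 : tabulates (table1 n) 1%g.
Proof.
by move=> k l kn ln; rewrite /entry !nth_mkseq // root1 // /alpha x_eq // eq_sym.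
Qed.

(** Faithfulness turns a period computed on tables into a relation in the group. *)
Lemma tabulates_eq1 w : tabulates (table1 n) w -> w = 1%g.
Proof.
move=> gw; apply: rep_faithful => // y; have [k kn ->] := x_surj y.
apply/funext => z; have [l ln ->] := x_surj z.
by rewrite -gw // tabulates1 // root1.
Qed.

Lemma tabulates_mulgen g w i : i < n -> tabulates g w ->
  tabulates (table_mulgen n g i) (w * cox_gen M (x i))%g.
Proof.
move=> ltin gw k l kn ln; rewrite root_mulgen // pairing_alpha x_eq // x_edge //.
rewrite {1}/entry nth_mkseq // eq_sym; case: eqP => [<-|_].
  by rewrite nth_mkseq // gw //; move: (root _ _ _) => c; ring.
case: (E_adj i k); first by rewrite nth_mkseq // !gw // opprK mul1r.
by rewrite -/(entry g k l) gw //= opprK mul0r add0r.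
Qed.

Lemma tabulates_mul g w u : all (gtn n) u -> tabulates g w ->
  tabulates (table_mul n g u) (w * cox_word M (map x u))%g.
Proof.
elim: u g w => [|i u IHu] g w /=; first by rewrite mulg1.
case/andP=> ltin un gw; rewrite -cat1s cox_word_cat mulgA.
by apply: IHu => //; apply: tabulates_mulgen.
Qed.

Lemma tabulates_word u : all (gtn n) u ->
  tabulates (table_mul n (table1 n) u) (cox_word M (map x u)).
Proof.
by move=> un; rewrite -[cox_word _ _]mul1g; apply: tabulates_mul tabulates1.
Qed.

Lemma tabulates_alternating u v k : all (gtn n) u -> all (gtn n) v ->
  tabulates (table_alternating n u v k)
    (alternating (cox_word M (map x u)) (cox_word M (map x v)) k).
Proof.
move=> un vn; elim: k => [|k IHk] /=; first exact: tabulates1.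
by case: ifP => _; apply: tabulates_mul.
Qed.

Lemma table_ascentE g w i : i < n -> tabulates g w ->
  table_ascent n g i = ascent w (x i).
Proof.
move=> ltin gw; apply/all_iotaP/nonnegP => [w_ge0 y|w_ge0 l ln].
  by have [l ln ->] := x_surj y; rewrite -gw //; apply: w_ge0.
by rewrite gw.
Qed.

Definition bits_set m : {set I} := [set y | y \in map x (bits n m)].

Lemma mem_bits_set m k : k < n -> (x k \in bits_set m) = nth false m k.
Proof.
move=> kn; rewrite inE; apply/mapP/idP => [[i]|mk]; last first.
  by exists k => //; rewrite mem_bits mk.
by rewrite mem_bits => /andP[mi ltin] /eqP; rewrite x_eq // => /eqP->.
Qed.

Lemma bits_setC m : size m = n -> bits_set (map negb m) = ~: bits_set m.
Proof.
move=> mn; apply/setP => y; have [k kn ->] := x_surj y.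
by rewrite finset.in_setC !mem_bits_set // (nth_negb mn kn).
Qed.

Lemma all_bits (p : pred nat) (q : pred I) m : (forall k, k < n -> p k = q (x k)) ->
  all p (bits n m) = [forall (y | y \in bits_set m), q y].
Proof.
move=> pq; apply/allP/forall_inP => [pm y|qm k].
  rewrite inE => /mapP[k km ->]; move: (km); rewrite mem_bits => /andP[_ kn].
  by rewrite -pq // pm.
by rewrite mem_bits => /andP[mk kn]; rewrite pq // qm // mem_bits_set.
Qed.

Lemma table_uniformE g w m : tabulates g w ->
  table_uniform n g (bits n m) = uniform w (bits_set m).
Proof.
move=> gw; rewrite /table_uniform (all_bits (q := ascent w)) => [|k kn]; last first.
  exact: table_ascentE.
rewrite (all_bits (q := fun y => ~~ ascent w y)) // => k kn.
by rewrite (table_ascentE kn gw).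
Qed.

Lemma is_longest_wordP m u : is_longest_word n (bits n m) u ->
  [/\ all (gtn n) u, parabolic (bits_set m) (cox_word M (map x u))
    & forall y, y \in bits_set m -> ~~ ascent (cox_word M (map x u)) y].
Proof.
case/andP=> /allP um /allP mu.
have un : all (gtn n) u.
  by apply/allP => k /um; rewrite /= mem_bits => /andP[].
split=> //.
  apply: parabolic_word; apply/allP => _ /mapP[k /um km ->].
  by rewrite /= inE map_f.
move=> y; rewrite inE => /mapP[k km ->]; have := mu _ km.
rewrite (table_ascentE _ (tabulates_word un)) //.
by move: km; rewrite mem_bits => /andP[].
Qed.

Lemma proper_coloringE m : two_partition [set bits_set m; ~: bits_set m] ->
  proper_coloring n m <-> bipartite_partition M [set bits_set m; ~: bits_set m].
Proof.
move=> P2; split=> [/all_iotaP cm|[_ bip]].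
  split=> // K PK y z; have [i ltin ->] := x_surj y; have [j ltjn ->] := x_surj z.
  have /all_iotaP/(_ _ ltjn)/implyP := cm _ ltin.
  rewrite x_edge // => mij iK jK; apply/negP => /mij.
  by move: PK iK jK; rewrite !inE => /orP[]/eqP->;
    rewrite ?finset.in_setC !mem_bits_set //; do 2!case: nth.
apply/all_iotaP => i ltin; apply/all_iotaP => j ltjn; apply/implyP => ij.
apply/eqP => mij; have no_edge K : K \in [set bits_set m; ~: bits_set m] ->
    x i \in K -> x j \in K -> False.
  by move=> PK iK jK; have := bip K PK _ _ iK jK; rewrite x_edge // ij.
have [mi|mi] := boolP (nth false m i).
  by apply: (no_edge (bits_set m)); rewrite ?mem_bits_set // -?mij // !inE eqxx.
by apply: (no_edge (~: bits_set m));
  rewrite ?finset.in_setC ?mem_bits_set // -?mij // !inE eqxx orbT.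
Qed.

Lemma cox_degree_x i : i < n -> cox_degree M (x i) = count (E_adj i) (iota 0 n).
Proof.
move=> ltin; rewrite -size_filter -(size_map x) /cox_degree.
have /card_uniqP <- : uniq (map x [seq j <- iota 0 n | E_adj i j]).
  rewrite map_inj_in_uniq ?filter_uniq ?iota_uniq // => j k.
  rewrite !mem_filter !mem_iota => /andP[_ /= jn] /andP[_ /= kn] /eqP.
  by rewrite x_eq // => /eqP.
apply: eq_card => y; have [j ltjn ->] := x_surj y; rewrite inE x_edge //.
apply/idP/mapP => [ij|[k]]; first by exists j; rewrite // mem_filter ij mem_iota.
by rewrite mem_filter mem_iota => /andP[ik kn] /eqP; rewrite x_eq // => /eqP->.
Qed.

Lemma leaf_bitsE m : leaf_bits n m = (bits_set m == cox_leaves M).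
Proof.
apply/all_iotaP/eqP => [lm|m_leaves k kn].
  apply/setP => y; have [k kn ->] := x_surj y.
  by rewrite mem_bits_set // (eqP (lm _ kn)) inE cox_degree_x.
by rewrite -mem_bits_set // m_leaves inE cox_degree_x.
Qed.

(** A 2-partition is unordered, so the leaves may be the part marked by [m] or its complement. *)
Lemma leaf_partitionE m : size m = n ->
  leaf_bits n m || leaf_bits n (map negb m)
  <-> [set bits_set m; ~: bits_set m] = [set cox_leaves M; ~: cox_leaves M].
Proof.
move=> mn; rewrite !leaf_bitsE bits_setC //; split=> [/orP[]/eqP mL|e].
- by rewrite mL.
- by rewrite -mL finset.setCK finset.setUC.
have : bits_set m \in [set cox_leaves M; ~: cox_leaves M] by rewrite -e !inE eqxx.
by rewrite !inE => /orP[]/eqP->; rewrite ?finset.setCK eqxx ?orbT.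
Qed.

(** In the listed cases the computed period and uniformity give admissibility; in the others the
    computation finds a non-uniform product among the first ten, which refutes it. *)
Lemma admissible_bits h m : 0 < h -> size m = n -> check_bits n h m ->
  two_partition [set bits_set m; ~: bits_set m] ->
  admissible M [set bits_set m; ~: bits_set m] <->
  proper_coloring n m || (n == 6) && (leaf_bits n m || leaf_bits n (map negb m)).
Proof.
move=> h0 mn chk P2; move: chk.
rewrite /check_bits; cbv zeta; rewrite !all_alternatingE.
set u := longest_word _ _ _ _; set v := longest_word _ _ _ _.
(* Both parts of a partition are non-empty, so the trivial exit of [check_bits] is not taken. *)
have nonempty m' : bits_set m' \in [set bits_set m; ~: bits_set m] ->
    nilp (bits n m') = false.
  move=> Pm'; apply: contraTF Pm' => /nilP m'0.
  have -> : bits_set m' = finset.set0 by apply/setP => y; rewrite !inE m'0.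
  by case: P2 => /and3P[].
rewrite !nonempty ?bits_setC ?inE ?eqxx ?orbT // orbF; cbv match.
case/and3P => /is_longest_wordP[un Ju rJ] /is_longest_wordP[vn Jv rJ'].
rewrite bits_setC // in Jv rJ'.
have unifE k : ((fun g => table_uniform n g (bits n m)
      && table_uniform n g (bits n (map negb m))) \o table_alternating n u v) k
  = uniform_pair (bits_set m)
      (alternating (cox_word M (map x u)) (cox_word M (map x v)) k).
  have gk := @tabulates_alternating u v k un vn.
  by rewrite /uniform_pair -bits_setC // -!(table_uniformE _ gk).
case: ifP => [_ /andP[/eqP per /all_iotaP unif]|_ /negP not_unif].
  split=> // _; apply: (uniform_admissible _ Ju rJ Jv rJ' P2 h0) => //.
    by apply: tabulates_eq1; rewrite -per; apply: tabulates_alternating.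
  by move=> k kh; rewrite -unifE unif.
split=> // adm; case: not_unif; apply/all_iotaP => k _; rewrite unifE.
exact: (admissible_uniform _ Ju rJ Jv rJ').
Qed.

End TypeE.

(** * Transfer along the isomorphism and classification *)

Theorem proposition52 (I : finType) (M : coxeter_matrix I) (n : nat)
    (hn : n \in [:: 6; 7; 8]) (hM : cox_isomorphic (E_matrix n) M)
    (P : {set {set I}}) (hP : two_partition P) :
  admissible M P <->
  bipartite_partition M P
  \/ n = 6 /\ P = [set cox_leaves M; ~: cox_leaves M].
Proof.
have [h h0 chk] : exists2 h, 0 < h & all_bitseq n (check_bits n h).
  move: hn; rewrite !inE => /or3P[]/eqP->.
  - by exists 24; [|exact: check_E6].
  - by exists 18; [|exact: check_E7].
  - by exists 30; [|exact: check_E8].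
have n0 : 0 < n by move: hn; rewrite !inE; lia.
have [f [f' fK f'K] fM] := hM.
(* [insubd] makes the numbering total, sending every index from [n] on to the image of vertex 0. *)
pose x k := f (insubd (Ordinal n0) k).
have xM i j : i < n -> j < n -> M (x i) (x j) =
    if i == j then Some 1 else if E_adj i j then Some 3 else Some 2.
  move=> ltin ltjn; rewrite /x fM /= /E_entry -val_eqE /=.
  by rewrite !val_insubd ltin ltjn.
have x_surj y : exists2 k, k < n & y = x k.
  by exists (f' y) => //; rewrite /x valKd f'K.
(* One part is read off as a bit sequence; the other is its complement, since the two parts are
   disjoint and cover [I]. *)
have [m mn PE] : exists2 m, size m = n & P = [set bits_set n x m; ~: bits_set n x m].
  have [/and3P[/eqP covP tiP P0] /eqP/cards2P[J [K [JK PE]]]] := hP.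
  exists (mkseq (fun k => x k \in J) n); first by rewrite size_mkseq.
  have -> : bits_set n x (mkseq (fun k => x k \in J) n) = J.
    apply/setP => y; have [k kn ->] := x_surj y.
    by rewrite (mem_bits_set xM) // nth_mkseq.
  rewrite PE; congr [set J; _]; apply/setP => y; rewrite finset.in_setC.
  have : y \in finset.cover P by rewrite covP finset.in_setT.
  rewrite /finset.cover PE big_setU1 ?inE //= big_set1.
  have /setP/(_ y) : J :&: K = finset.set0.
    apply/eqP; rewrite setI_eq0; move/finset.trivIsetP: tiP; apply=> //.
      by rewrite PE !inE eqxx.
    by rewrite PE !inE eqxx orbT.
  by rewrite !inE; case: (y \in J); case: (y \in K).
have P2 := hP; rewrite PE in P2 *.
have adm := admissible_bits xM x_surj h0 mn (all_bitseqP chk mn) P2.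
have bip := proper_coloringE xM x_surj P2.
have leaf := leaf_partitionE xM x_surj mn.
split=> [/adm/orP[/bip|/andP[/eqP n6 /leaf]]|[/bip col|[n6 /leaf lm]]].
- by left.
- by right.
- by apply/adm; rewrite col.
- by apply/adm; rewrite lm n6 orbT.
Qed.
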